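(* Let $N$ be a positive integer and $d_1,\dots,d_N\ge 2$ be integers. Suppose there exists a subset $A\subseteq[N]=\{1,\dots,N\}$ with $|A|=\lfloor N/2\rfloor+2$ such that $$ \frac{\prod_{i\in A}d_i^2}{d_1d_2\cdots d_N}\left(1-\sum_{i\in A}\frac{1}{d_i^2}\right)+\left\lfloor\frac N2\right\rfloor+1<0 . $$ Then there is no absolutely maximally entangled (AME) state in $\mathbb{C}^{d_1}\otimes\mathbb{C}^{d_2}\otimes\cdots\otimes\mathbb{C}^{d_N}$.
   Context: A pure state in $\mathbb{C}^{d_1}\otimes\cdots\otimes\mathbb{C}^{d_N}$ is a unit vector $|\psi\rangle$, with density matrix $\rho=|\psi\rangle\langle\psi|$. For $B\subseteq[N]$, the reduced density matrix $\rho_B$ is the partial trace of $\rho$ over the tensor factors indexed by $[N]\setminus B$. The state $|\psi\rangle$ is called an absolutely maximally entangled (AME) state if for every subset $B\subseteq[N]$ with $|B|=\lfloor N/2\rfloor$, $\rho_B$ is maximally mixed, i.e. $\rho_B=\frac{1}{\prod_{i\in B}d_i}I$. *)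

(* Defs.v *)
From HB Require Import structures.
From mathcomp Require Import all_boot all_order all_algebra.
From mathcomp Require Import complex reals.

Set Implicit Arguments.
Unset Strict Implicit.
Unset Printing Implicit Defensive.

Import Order.TTheory GRing.Theory Num.Theory.
Local Open Scope ring_scope.

(* Complex numbers are [R[i]] over a [realType].  The tensor
   product of the C^(d i), i < N, is coordinatized in its product basis: a basis
   vector is a multi-index u with [u i : 'I_(d i)].  [enum_rank] numbers the
   multi-indices, so that vectors and operators are MathComp matrices. *)

Definition multi_index (N : nat) (d : 'I_N -> nat) : finType :=
  {dffun forall i : 'I_N, 'I_(d i)}.

Definition sub_index (N : nat) (d : 'I_N -> nat) (B : {set 'I_N}) : finType :=
  {dffun forall i : {i : 'I_N | i \in B}, 'I_(d (val i))}.

Definition restrict_index (N : nat) (d : 'I_N -> nat) (B : {set 'I_N})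
    (u : multi_index d) : sub_index d B :=
  [ffun i : {i : 'I_N | i \in B} => u (val i) : 'I_(d (val i))].

Definition tensor_vector (R : realType) (N : nat) (d : 'I_N -> nat) : Type :=
  'cV[R[i]]_#|multi_index d|.

Definition pure_state (R : realType) (N : nat) (d : 'I_N -> nat)
    (psi : tensor_vector R d) : Prop :=
  \sum_k `|psi k 0| ^+ 2 = 1.

Definition density_matrix (R : realType) (N : nat) (d : 'I_N -> nat)
    (psi : tensor_vector R d) : 'M[R[i]]_#|multi_index d| :=
  psi *m map_mx Num.conj psi^T.

(* The (x, y) entry sums <u| rho |v> over all u, v that restrict to x, y on B
   and agree off B; thus the factors outside B are traced out. *)
Definition reduced_matrix (R : realType) (N : nat) (d : 'I_N -> nat)
    (B : {set 'I_N}) (rho : 'M[R[i]]_#|multi_index d|) :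
    'M[R[i]]_#|sub_index d B| :=
  \matrix_(x, y)
    \sum_(u : multi_index d | restrict_index B u == enum_val x)
    \sum_(v : multi_index d | (restrict_index B v == enum_val y)
                              && (restrict_index (~: B) u
                                  == restrict_index (~: B) v))
      rho (enum_rank u) (enum_rank v).

Definition maximally_mixed (R : realType) (N : nat) (d : 'I_N -> nat)
    (B : {set 'I_N}) : 'M[R[i]]_#|sub_index d B| :=
  (\prod_(i in B) (d i)%:R)^-1 *: 1%:M.

Definition AME (R : realType) (N : nat) (d : 'I_N -> nat)
    (psi : tensor_vector R d) : Prop :=
  pure_state psi /\
  forall B : {set 'I_N}, #|B| = (N %/ 2)%N ->
    reduced_matrix B (density_matrix psi) = maximally_mixed R d B.

(* Main.v *)
(* Let m = floor(N/2).  For every set A of sites, projecting the reduction of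
   |psi><psi| to A on its traceless part at each site of A yields an operator
   whose squared norm is
     sum_(J <= A) (-1)^|A \ J| tr(rho_J^2) / prod_(i in A \ J) d_i >= 0.
   For an AME state, tr(rho_J^2) is 1 / prod_(i in J) d_i when |J| <= m, and by
   the Schmidt symmetry rho_J <-> rho_(~J) it is prod_(i in J) d_i / prod_i d_i
   when |J| >= N - m.  If |A| = m + 2 these two cases cover all J <= A, and the
   alternating sum is, up to a positive factor, the left-hand side of the
   hypothesis. *)

Require Import Defs.
From HB Require Import structures.
From mathcomp Require Import all_boot all_order all_algebra.
From mathcomp Require Import complex reals ring zify.

Set Implicit Arguments.
Unset Strict Implicit.
Unset Printing Implicit Defensive.

Import Order.TTheory GRing.Theory Num.Theory.
Local Open Scope ring_scope.

(** * Distributivity over dependent families and Gram kernels *)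

(** Distributivity with a site-dependent index type: the sums move to the common tagged type, and of
    the choice functions there only the sections [fprod T] contribute. *)
Lemma prod_sum_dffun (C : comNzRingType) (I : finType) (T : I -> finType)
    (F : forall i, T i -> C) :
  \prod_i \sum_(x : T i) F i x
  = \sum_(u : {dffun forall i, T i}) \prod_i F i (u i).
Proof.
have bij := @fprod_of_dffun_bij I T.
under eq_bigr => i _ do rewrite (big_tag (fun i x => F i x)).
rewrite bigA_distr_big_dep.
have H := @big_fprod C 0 1 _ +%R I T (fun i => [ffun x => F i x]).
transitivity (\sum_(t : fprod T) \prod_i F i (t i)).
  rewrite -[RHS](@eq_bigr _ _ _ _ _ _ (fun t : fprod T => \prod_i [ffun x => F i x] (t i))).
    rewrite H; apply: eq_bigr => g _; apply: eq_bigr => i _.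
    by rewrite /untag; case: eqP => // e; rewrite ffunE.
  by move=> t _; apply: eq_bigr => i _; rewrite ffunE.
rewrite (reindex (@fprod_of_dffun I T)); last exact: onW_bij.
by apply: eq_bigr => u _; apply: eq_bigr => i _; rewrite /fprod_of_dffun fprodE.
Qed.

Lemma exists_superset_card (T : finType) (S : {set T}) (k : nat) :
  (#|S| <= k)%N -> (k <= #|T|)%N -> exists2 B : {set T}, S \subset B & #|B| = k.
Proof.
elim: k => [|k IHk]; first by rewrite leqn0 => /eqP; exists S.
rewrite leq_eqVlt => /orP[/eqP|cardS]; first by exists S.
move=> cardT; have [//||B sSB cardB] := IHk; first exact: ltnW.
have [x xB] : exists x, x \in ~: B.
  by apply/card_gt0P; move: (cardsC B); rewrite cardB; lia.
exists (x |: B); first exact: subset_trans sSB (subsetUr _ _).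
by rewrite cardsU1 cardB; move: xB; rewrite inE => ->.
Qed.

Lemma sum_delta (C : nzSemiRingType) (n : nat) : \sum_(x < n) (x == x)%:R = n%:R :> C.
Proof. by under eq_bigr do rewrite eqxx; rewrite sumr_const card_ord. Qed.

(** A product of Gram kernels is a Gram kernel: distributing over the choices of one [q] per site
    turns the form into a nonnegative multiple of a sum of squared moduli. *)
Lemma hermitian_form_ge0 (C : numClosedFieldType) (I P : finType)
    (T : I -> finType) (pr : P -> forall i, T i) (c : I -> C)
    (f : forall i, T i -> T i -> C) (F : P -> C) :
  (forall i, 0 <= c i) ->
  0 <= \sum_p \sum_p' F p * (F p')^*
         * \prod_i (c i * \sum_q f i (pr p i) q * (f i (pr p' i) q)^*).
Proof.
move=> c_ge0; set S := (X in 0 <= X).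
suff -> : S = \prod_i c i * \sum_(q : {dffun forall i, T i})
                `|\sum_p F p * \prod_i f i (pr p i) (q i)| ^+ 2.
  apply: mulr_ge0; first exact: prodr_ge0.
  by apply: sumr_ge0 => q _; apply: exprn_ge0.
rewrite /S mulr_sumr.
transitivity (\sum_(q : {dffun forall i, T i}) \sum_p \sum_p' \prod_i c i
    * ((F p * \prod_i f i (pr p i) (q i)) * (F p' * \prod_i f i (pr p' i) (q i))^*)).
  2: by apply: eq_bigr => q _; rewrite normCK rmorph_sum mulr_suml mulr_sumr;
    apply: eq_bigr => p _; rewrite !mulr_sumr.
rewrite [RHS]exchange_big; apply: eq_bigr => p _.
rewrite [RHS]exchange_big; apply: eq_bigr => p' _.
rewrite big_split /= (prod_sum_dffun (fun i q => f i (pr p i) q * (f i (pr p' i) q)^*)).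
rewrite !mulr_sumr; apply: eq_bigr => q _.
by rewrite big_split /= rmorphM rmorph_prod; ring.
Qed.

(** * Purities of the reductions of a pure state *)

Definition outer (C : numClosedFieldType) (T : finType) (psi : T -> C)
  (p : T * T) : C := psi p.1 * (psi p.2)^*.

(* [tr (rho_S ^ 2)], where [rho_S] is the reduction of [|psi><psi|] to [S]. *)
Definition purity (C : numClosedFieldType) (I : finType) (T : I -> finType)
    (psi : {dffun forall i, T i} -> C) (S : {set I}) : C :=
  \sum_p \sum_p' outer psi p * (outer psi p')^*
    * \prod_i (if i \in S then ((p.1 i == p'.1 i) && (p.2 i == p'.2 i))%:R
               else ((p.1 i == p.2 i) && (p'.1 i == p'.2 i))%:R).

(** Reindexing by ((a, b), (c, e)) -> ((a, c), (b, e)) fixes the coefficient and exchanges the two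
    kinds of delta, so no Schmidt decomposition is required. *)
Lemma purityC (C : numClosedFieldType) (I : finType) (T : I -> finType)
    (psi : {dffun forall i, T i} -> C) (S : {set I}) :
  purity psi (~: S) = purity psi S.
Proof.
rewrite /purity !pair_bigA /=.
pose sw (w : ({dffun forall i, T i} * {dffun forall i, T i})
  * ({dffun forall i, T i} * {dffun forall i, T i})) :=
  ((w.1.1, w.2.1), (w.1.2, w.2.2)).
have swK : involutive sw by case=> [[a b] [c e]].
rewrite (reindex_inj (inv_inj swK)) /=; apply: eq_bigr => -[[a b] [c e]] _ /=.
rewrite /outer /= !rmorphM /= !conjCK; congr (_ * _); first by ring.
by apply: eq_bigr => i _; rewrite inE; case: (i \in S).
Qed.

(* [tr (rho_S (f_1 (x) ... (x) f_k))] agrees with its value on the maximally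
   mixed state of [S]. *)
Definition locally_mixed (C : numClosedFieldType) (I : finType) (d : I -> nat)
    (psi : {dffun forall i, 'I_(d i)} -> C) (S : {set I}) : Prop :=
  forall f : forall i, 'I_(d i) -> 'I_(d i) -> C,
  \sum_p outer psi p
    * \prod_i (if i \in S then f i (p.1 i) (p.2 i) else (p.1 i == p.2 i)%:R)
  = \prod_(i in S) ((\sum_x f i x x) / (d i)%:R).

Section Purity.
Variables (C : numClosedFieldType) (I : finType) (d : I -> nat).
Hypothesis d_gt0 : forall i, (0 < d i)%N.
Variable psi : {dffun forall i, 'I_(d i)} -> C.

Let d_neq0 i : (d i)%:R != 0 :> C.
Proof. by rewrite pnatr_eq0 -lt0n. Qed.

(** The identity as test operator traces out a site of [B :\: S] and contributes d/d = 1. *)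
Lemma locally_mixedS (S B : {set I}) :
  S \subset B -> locally_mixed psi B -> locally_mixed psi S.
Proof.
move=> sSB mixB f.
have := mixB (fun i x y => if i \in S then f i x y else (x == y)%:R).
rewrite (big_setID S) (setIidPr sSB) /= [X in _ = _ * X]big1 => [|i]; last first.
  by rewrite inE => /andP[/negPf-> _]; rewrite sum_delta divff.
rewrite mulr1 => H; transitivity (\prod_(i in S)
  ((\sum_x (if i \in S then f i x x else (x == x)%:R)) / (d i)%:R)).
  rewrite -H; apply: eq_bigr => p _; congr (_ * _); apply: eq_bigr => i _.
  by case: (boolP (i \in S)) => [/(subsetP sSB)->|_] //; rewrite if_same.
by apply: eq_bigr => i ->.
Qed.

(** The hypothesis is applied twice: for fixed [p'] the sum over [p] is a test against matrix units,
    and what remains is a test against the identity divided by [d i] at each site of [S]. *)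
Lemma purity_mixed (S : {set I}) :
  locally_mixed psi S -> purity psi S = \prod_(i in S) (d i)%:R^-1.
Proof.
move=> mixS; rewrite /purity exchange_big /=.
transitivity ((\sum_p outer psi p * \prod_i (if i \in S
   then (p.1 i == p.2 i)%:R / (d i)%:R else (p.1 i == p.2 i)%:R))^*).
  rewrite rmorph_sum; apply: eq_bigr => p' _.
  transitivity ((outer psi p')^*
      * \prod_i (if i \in S then 1 else (p'.1 i == p'.2 i)%:R)
      * \prod_(i in S) ((\sum_x ((x == p'.1 i) && (x == p'.2 i))%:R) / (d i)%:R)).
    rewrite -(mixS (fun i x y => ((x == p'.1 i) && (y == p'.2 i))%:R)).
    rewrite mulr_sumr; apply: eq_bigr => p _.
    rewrite [_ * (outer _ _)^*]mulrC -2!mulrA; congr (_ * _).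
    rewrite [RHS]mulrCA; congr (_ * _); rewrite -big_split /=; apply: eq_bigr => i _.
    by case: (i \in S); rewrite ?mul1r // -natrM mulnb andbC.
  rewrite rmorphM -mulrA rmorph_prod; congr (_ * _).
  rewrite [\prod_(i in S) _]big_mkcond;  rewrite -big_split; apply: eq_bigr => i _ /=.
  case: (i \in S); last by rewrite mulr1 rmorph_nat.
  rewrite mul1r rmorphM fmorphV !rmorph_nat; congr (_ / _).
  rewrite (bigD1 (p'.1 i)) //= eqxx big1 ?addr0 // => x /negPf-> //.
rewrite (mixS (fun i x y => (x == y)%:R / (d i)%:R)) rmorph_prod.
apply: eq_bigr => i _; rewrite -mulr_suml sum_delta divff // mul1r.
by rewrite fmorphV rmorph_nat.
Qed.

(* For [i \in A] the kernel of the form at site [i] is the orthogonal projector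
   on traceless matrices; elsewhere it is that of the partial trace. *)
Lemma shadow_inequality (A : {set I}) :
  0 <= \sum_(J : {set I}) purity psi J
        * \prod_i (if i \in J then (i \in A)%:R
                   else if i \in A then - (d i)%:R^-1 else 1).
Proof.
(* [e] is the identity matrix viewed as a vector, of squared norm n. *)
pose e n (x : 'I_n * 'I_n) : C := (x.1 == x.2)%:R.
have sum_e n : \sum_x e n x = n%:R.
  rewrite -(pair_bigA _ (fun a b => (a == b)%:R)) /= -[RHS]sum_delta.
  apply: eq_bigr => a _.
  by rewrite (bigD1 a) //= big1 ?addr0 // => b; rewrite eq_sym => /negPf->.
have ee n x : e n x * e n x = e n x by rewrite -natrM mulnb andbb.
have pick (U : finType) (x : U) (g : U -> C) : \sum_q (x == q)%:R * g q = g x.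
  rewrite (bigD1 x) //= eqxx mul1r big1 ?addr0 // => q.
  by rewrite eq_sym => /negPf->; rewrite mul0r.
pose f i (x q : 'I_(d i) * 'I_(d i)) : C :=
  if i \in A then (x == q)%:R - e _ x * e _ q / (d i)%:R else e _ x * e _ q.
(* Outside [A] the sum over [q] produces a spurious factor [d i]; the weight cancels it and avoids a
   square root in [f]. *)
pose c i : C := if i \in A then 1 else (d i)%:R^-1.
have c_ge0 i : 0 <= c i by rewrite /c; case: ifP; rewrite ?invr_ge0 ?ler0n.
have kernel i x x' : c i * \sum_q f i x q * (f i x' q)^*
    = (i \in A)%:R * (x == x')%:R
      + (if i \in A then - (d i)%:R^-1 else 1) * (e _ x * e _ x').
  rewrite /c /f /e; case: (i \in A).
    transitivity (\sum_q ((x == q)%:R * ((x' == q)%:R - e _ x' * e _ q / (d i)%:R)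
       - (x' == q)%:R * (e _ x * e _ q / (d i)%:R)
       + e _ x * e _ x' / (d i)%:R ^+ 2 * (e _ q * e _ q))).
      rewrite mul1r; apply: eq_bigr => q _.
      rewrite rmorphB !rmorphM fmorphV !rmorph_nat /e.
      by field.
    rewrite !big_split /= sumrN !pick -mulr_sumr (eq_bigr _ (fun q _ => ee _ q)) sum_e /e eq_sym.
    by field.
  rewrite mul0r add0r mul1r.
  under eq_bigr => q _.
    rewrite rmorphM !rmorph_nat mulrACA -/(e _ q) ee.
    over.
  by rewrite -mulr_sumr sum_e /e; field.
have := @hermitian_form_ge0 C I _ (fun i => ('I_(d i) * 'I_(d i))%type)
  (fun (p : {dffun forall i, 'I_(d i)} * {dffun forall i, 'I_(d i)}) i => (p.1 i, p.2 i)) c f (outer psi) c_ge0.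
set L := (X in 0 <= X); set Rt := (X in _ -> 0 <= X); suff -> : L = Rt by [].
rewrite /Rt /purity /L.
under [RHS]eq_bigr do rewrite mulr_suml.
rewrite [RHS]exchange_big /=; apply: eq_bigr => p _.
under [RHS]eq_bigr do rewrite mulr_suml.
rewrite [RHS]exchange_big /=; apply: eq_bigr => p' _.
under [RHS]eq_bigr do rewrite -mulrA.
rewrite -mulr_sumr; congr (_ * _).
under eq_bigr do rewrite kernel.
(* [J] collects the sites where the first summand of [kernel] is chosen. *)
rewrite bigA_distr; apply: eq_bigr => J _; rewrite -big_split /=.
apply: eq_bigr => i _; rewrite xpair_eqE [RHS]mulrC.
by case: (i \in J); rewrite /e /= -natrM mulnb.
Qed.

(** * The alternating sum for locally mixed states *)

(** The bound on [#|I|] makes the complement of any set of more than m sites have at most m; within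
    [A] such sets are only [A] and the [A :\ i]. *)
Lemma mixed_inequality (m : nat) (A : {set I}) :
  (forall S : {set I}, (#|S| <= m)%N -> locally_mixed psi S) ->
  (#|I| <= m.*2.+1)%N -> #|A| = m.+2 ->
  0 <= (\prod_(i in A) (d i)%:R ^+ 2) / (\prod_i (d i)%:R)
         * (1 - \sum_(i in A) 1 / (d i)%:R ^+ 2) + m%:R + 1 :> C.
Proof.
move=> mix cardI cardA.
pose D : C := \prod_i (d i)%:R; pose dA : C := \prod_(i in A) (d i)%:R.
have D_neq0 : D != 0 by apply/prodf_neq0 => i _.
have dA_neq0 : dA != 0 by apply/prodf_neq0 => i _.
pose w (J : {set I}) : C := \prod_i (if i \in J then (i \in A)%:R
   else if i \in A then - (d i)%:R^-1 else 1).
(* For J inside [A] this is the sign (-1)^|A \ J|, the value of [dA * (purity psi J * w J)] when the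
   reduction to J is maximally mixed. *)
pose s (J : {set I}) : C := \prod_i (if i \in J then (i \in A)%:R
   else if i \in A then - 1 else 1).
have w_outside (J : {set I}) : ~~ (J \subset A) -> w J = 0 /\ s J = 0.
  case/subsetPn => i iJ iA.
  by rewrite /w /s; split; rewrite (bigD1 i) //= iJ (negPf iA) mul0r.
have wE (J : {set I}) : J \subset A -> w J = \prod_(i in A :\: J) - (d i)%:R^-1.
  move=> /subsetP sJA; rewrite /w [RHS]big_mkcond; apply: eq_bigr => i _.
  by rewrite inE; case: (boolP (i \in J)) => [/sJA->|].
have sE (J : {set I}) : J \subset A -> s J = \prod_(i in A :\: J) - 1.
  move=> /subsetP sJA; rewrite /s [RHS]big_mkcond; apply: eq_bigr => i _.
  by rewrite inE; case: (boolP (i \in J)) => [/sJA->|].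
have sum_s : \sum_(J : {set I}) s J = 0.
  have [i iA] : exists i, i \in A by apply/card_gt0P; rewrite cardA.
  transitivity (\prod_i ((i \in A)%:R + (if i \in A then - 1 else 1)) : C).
    by rewrite bigA_distr.
  (* A site of [A] contributes the factor 1 - 1. *)
  rewrite (bigD1 i) //= iA.
  by rewrite subrr mul0r.
(* Since [s] sums to 0, subtracting it is harmless, and it cancels all [#|J| <= m]. *)
pose t (J : {set I}) := dA * (purity psi J * w J) - s J.
have sum_t : 0 <= \sum_(J : {set I}) t J.
  rewrite sumrB sum_s subr0 -mulr_sumr mulr_ge0 ?shadow_inequality //.
  by apply: prodr_ge0 => i _; rewrite ler0n.
have t_small (J : {set I}) : (#|J| <= m)%N -> t J = 0.
  move=> /mix mixJ; apply/eqP; rewrite subr_eq0 purity_mixed // /dA /w /s.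
  rewrite [\prod_(i in A) _]big_mkcond [\prod_(i in J) _]big_mkcond -!big_split /=.
  apply/eqP/eq_bigr => i _.
  case: (i \in J); case: (i \in A);
    rewrite ?mulr1 ?mul1r ?mulr0 ?mulfV ?mulrN ?mulfV //.
have purity_large (J : {set I}) : (#|~: J| <= m)%N -> purity psi J = (\prod_(i in J) (d i)%:R) / D.
  move=> /mix mixJ; rewrite -purityC purity_mixed // prodfV.
  have -> : D = (\prod_(i in J) (d i)%:R) * \prod_(i in ~: J) (d i)%:R.
    rewrite /D (bigID (mem J)) /=; congr (_ * _).
    by apply: eq_bigl => i; rewrite inE.
  rewrite invfM mulrA divff ?mul1r //; exact/prodf_neq0.
have tA : t A = dA ^+ 2 / D - 1.
  rewrite /t wE // sE // setDv !big_set0 mulr1 purity_large; first by rewrite -/dA; field.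
  by rewrite cardsCs setCK cardA; lia.
have tD i : i \in A -> t (A :\ i) = 1 - dA ^+ 2 / D / (d i)%:R ^+ 2.
  move=> iA; have sub : A :\ i \subset A by rewrite subsetDl.
  have diff : A :\: (A :\ i) = [set i].
    by apply/setP => j; rewrite !inE; case: eqP => [->|_]; rewrite ?iA //= andNb.
  rewrite /t wE // sE // diff !big_set1 purity_large.
    have -> : dA = (d i)%:R * \prod_(j in A :\ i) (d j)%:R.
      by rewrite /dA (big_setD1 i).
    by field; rewrite D_neq0 d_neq0.
  by rewrite cardsCs setCK; move: (cardsD1 i A); rewrite iA cardA; lia.
have sum_tE : \sum_(J : {set I}) t J = t A + \sum_(i in A) t (A :\ i).
  rewrite (bigD1 A) //=; congr (_ + _).
  rewrite (bigID (mem [set A :\ i | i in A])) /= [X in _ + X]big1 ?addr0.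
    rewrite -(@big_imset _ _ _ _ _ (fun i => A :\ i) (mem A) t) /=.
      apply: eq_bigl => J; case: imsetP; rewrite ?andbF // => -[i iA ->].
      rewrite andbT; apply/eqP => /setP/(_ i).
      by rewrite !inE eqxx iA.
    move=> i j iA jA /setP/(_ i); rewrite !inE eqxx iA andbT /=.
    by case: (i =P j).
  move=> J /andP[JnA Jim].
  have [sJA|/w_outside[wJ sJ]] := boolP (J \subset A); last first.
    by rewrite /t wJ sJ !mulr0 subrr.
  apply: t_small; rewrite leqNgt; apply: contra Jim => cardJ.
  (* Here m < |J| < |A| = m + 2, so exactly one site is missing. *)
  have /cards1P[i AJ] : #|A :\: J| == 1%N.
    have : (#|J| < #|A|)%N by apply: proper_card; rewrite properEneq JnA.
    by rewrite cardsDS // cardA; lia.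
  have iA : i \in A by have := set11 i; rewrite -AJ inE => /andP[].
  apply/imsetP; exists i => //.
  by rewrite -AJ setDDr setDv set0U (setIidPr sJA).
move: sum_t; rewrite sum_tE tA (eq_bigr _ tD) sumrB sumr_const cardA.
rewrite -(mulr_sumr _ _ _ (dA ^+ 2 / D)) prodrXl -/dA -/D -(addn2 m) natrD.
under [\sum_(i in A) 1 / _]eq_bigr do rewrite div1r.
(* The sum is now (x - 1) + ((m + 2) - x y) = x (1 - y) + m + 1. *)
set x := _ / _; set y := \sum_(i in A) _; set L := (X in 0 <= X).
by move=> L_ge0; suff -> : x * (1 - y) + m%:R + 1 = L by []; rewrite /L; ring.
Qed.

End Purity.

(** * From reduced density matrices to product tests *)

(** Both sides are the entrywise pairing of the reduced matrix with the product kernel [g]; for the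
    maximally mixed matrix only the diagonal survives, and its sum factors over sites. *)
Lemma reduced_matrix_locally_mixed (R : realType) (N : nat) (d : 'I_N -> nat)
    (psi : tensor_vector R d) (B : {set 'I_N}) :
  reduced_matrix B (density_matrix psi) = maximally_mixed R d B ->
  locally_mixed (fun u : multi_index d => psi (enum_rank u) 0) B.
Proof.
move=> red f.
pose g (x y : sub_index d B) := \prod_i f (val i) (x i) (y i).
transitivity (\sum_x \sum_y reduced_matrix B (density_matrix psi) x y
                * g (enum_val x) (enum_val y)); last first.
  rewrite red; transitivity (\sum_(x : sub_index d B)
    (\prod_(i in B) (d i)%:R)^-1 * g x x).
    rewrite [RHS](reindex _ (onW_bij _ (@enum_val_bij (sub_index d B)))) /=; apply: eq_bigr => x _.
    rewrite (bigD1 x) //= !mxE eqxx mulr1 [X in _ + X]big1 ?addr0 // => y.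
    by rewrite !mxE eq_sym => /negPf->; rewrite mulr0 mul0r.
  rewrite -mulr_sumr /g -(prod_sum_dffun (fun i x => f (val i) x x)).
  rewrite big_split /= prodfV mulrC; congr (_ * _).
  by rewrite [RHS]big_sub.
transitivity (\sum_(u : multi_index d) \sum_(v : multi_index d)
    psi (enum_rank u) 0 * (psi (enum_rank v) 0)^*
    * \prod_i (if i \in B then f i (u i) (v i) else (u i == v i)%:R)).
  by rewrite pair_bigA.
(* Grouping [u] and [v] by their restrictions to [B] recovers the entries of the reduced matrix; the
   deltas off [B] become its agreement condition. *)
rewrite (partition_big (fun u => enum_rank (restrict_index B u)) predT) //=.
apply: eq_bigr => x _.
under [RHS]eq_bigr do rewrite mxE mulr_suml.
rewrite [RHS]exchange_big /=; apply: eq_big => u.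
  by rewrite (can2_eq enum_rankK enum_valK).
move=> /eqP xE.
rewrite (partition_big (fun u => enum_rank (restrict_index B u)) predT) //=.
apply: eq_bigr => y _; rewrite mulr_suml.
rewrite [RHS]big_mkcondr /=; apply: eq_big => v.
  by rewrite (can2_eq enum_rankK enum_valK).
move=> /eqP yE.
have -> : \prod_i (if i \in B then f i (u i) (v i) else (u i == v i)%:R)
    = g (enum_val x) (enum_val y)
      * (restrict_index (~: B) u == restrict_index (~: B) v)%:R.
  rewrite (bigID (mem B)) /=; congr (_ * _).
    rewrite (eq_bigr (fun i => f i (u i) (v i))); last by move=> i ->.
    rewrite big_sub /g -xE -yE !enum_rankK; apply: eq_bigr => i _.
    by rewrite !ffunE.
  case: eqP => [/ffunP uv|uv].
    rewrite big1 // => i iB; rewrite (negPf iB).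
    have iC : i \in ~: B by rewrite inE.
    by have := uv (exist _ i iC); rewrite !ffunE /= => ->; rewrite eqxx.
  apply/eqP/prodf_eq0; have /existsP[i /eqP ui] :
      [exists i, restrict_index (~: B) u i != restrict_index (~: B) v i].
    rewrite -negb_forall; apply/forallP => H; case: uv; apply/ffunP => i.
      exact/eqP/H.
  exists (val i); first by have := valP i; rewrite inE.
  have := valP i; rewrite inE => /negPf->.
  by move/eqP: ui; rewrite !ffunE => /negPf->.
case: (_ == _); last by rewrite !mulr0.
by rewrite mulr1 /density_matrix !mxE big_ord1 !mxE.
Qed.

(** * Nonexistence of AME states *)

Theorem theorem10 (R : realType) (N : nat) (N_gt0 : (0 < N)%N)
    (d : 'I_N -> nat) (d_ge2 : forall i : 'I_N, (2 <= d i)%N)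
    (hA : exists A : {set 'I_N},
        #|A| = (N %/ 2 + 2)%N /\
        (\prod_(i in A) (d i)%:R ^+ 2) / (\prod_(i < N) (d i)%:R)
          * (1 - \sum_(i in A) 1 / (d i)%:R ^+ 2)
          + (N %/ 2)%:R + 1 < 0 :> R) :
  ~ exists psi : tensor_vector R d, AME psi.
Proof.
case: hA => A [cardA lt0] [psi [_ ame]].
have d_gt0 i : (0 < d i)%N by exact: leq_trans (d_ge2 i).
have mix (S : {set 'I_N}) : (#|S| <= N %/ 2)%N ->
    locally_mixed (fun u : multi_index d => psi (enum_rank u) 0) S.
  move=> cardS.
  (* AME speaks of sets of size exactly [N %/ 2]; smaller ones inherit mixedness from a superset. *)
  have [|B sSB cardB] := exists_superset_card cardS.
    by rewrite card_ord leq_div.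
  apply: locally_mixedS sSB _ => //.
  exact/reduced_matrix_locally_mixed/ame.
rewrite addn2 in cardA.
have cardN : (#|'I_N| <= (N %/ 2).*2.+1)%N by rewrite card_ord; lia.
have ge0 := mixed_inequality d_gt0 mix cardN cardA.
move: lt0; rewrite ltNge => /negP; apply.
(* The hypothesis lives in [R] and [ge0] in [R[i]]; the embedding respects order and field
   operations. *)
rewrite -lecR; move: ge0; congr (_ <= _).
rewrite !rmorphD rmorphM fmorph_div !rmorph_prod rmorphB rmorph_sum.
rewrite rmorph_nat rmorph1; do 2 congr (_ + _); congr (_ / _ * (1 - _)).
- by apply: eq_bigr => i _; rewrite rmorphXn rmorph_nat.
- by apply: eq_bigr => i _; rewrite rmorph_nat.
- by apply: eq_bigr => i _; rewrite fmorph_div rmorph1 rmorphXn rmorph_nat.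
Qed.
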